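(* Let $G$ be a self-similar subgroup of $\mathrm{Aut}(\mathcal T_3)$ acting spherically transitively. Suppose there is a vertex $v\in L_1=\{1,2,3\}$ such that the group $\mathrm{Stab}_G(v\mathcal T_3)\cap\mathrm{Stab}_G(L_1)\neq\{1\}$. Then the $*$-homomorphism $\rho$ defined on $\mathbb C G$ is not injective.
   Context: $\mathcal T_3$ is the $3$-regular rooted tree: its vertex set $\mathcal T_3^0$ is the set of finite words over $\{1,2,3\}$, the root is the empty word, and each $w$ is joined to $w1,w2,w3$. $L_n$ is the $n$-th level (words of length $n$). For a vertex $v$, $v\mathcal T_3$ is the subtree of vertices having $v$ as a prefix. $\mathrm{Aut}(\mathcal T_3)$ is the group of rooted tree automorphisms. For $g\in\mathrm{Aut}(\mathcal T_3)$ and a vertex $v$, $\varphi_{g(v)}(g)\in\mathrm{Aut}(\mathcal T_3)$ is defined by $g(vw)=g(v)\,\varphi_{g(v)}(g)(w)$ for all words $w$. $G$ is self-similar if $\varphi_v(g)\in G$ for all $g\in G$ and all vertices $v$. $G$ acts spherically transitively if it acts transitively on every level $L_n$. For a set $A$, $\mathrm{Stab}_G(A)=\{g\in G\mid g(a)=a\ \forall a\in A\}$ is the pointwise stabilizer. $\rho$ is the unitary representation of $G$ on $\ell^2(\mathcal T_3^0)$ given by $(\rho(g)\xi)(x)=\xi(g^{-1}x)$, extended by linearity to a $*$-homomorphism $\rho:\mathbb C G\to\mathcal B(\ell^2(\mathcal T_3^0))$ on the group algebra. *)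

(* Defs.v *)
From HB Require Import structures.
From mathcomp Require Import all_boot all_order all_algebra finmap.
From mathcomp Require Import complex monalg.
From mathcomp Require Import zify lra.
From mathcomp Require Import all_classical all_reals ereal esum.

Set Implicit Arguments.
Unset Strict Implicit.
Unset Printing Implicit Defensive.

Import Order.TTheory GRing.Theory Num.Theory.
Import ComplexField.Normc.

Local Open Scope classical_set_scope.
Local Open Scope ring_scope.

(* The letters 1, 2, 3 are the elements of 'I_3; the root is [::]. *)
Definition vertex : Type := seq 'I_3.
HB.instance Definition _ := Choice.on vertex.

Definition child (u w : vertex) : bool := [exists i, w == rcons u i].

Definition tree_adj (u w : vertex) : bool := child u w || child w u.

Definition level (n : nat) : set vertex := [set x : vertex | size x = n].

Definition subtree (v : vertex) : set vertex := [set x : vertex | prefix v x].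

Definition is_tree_aut (f : vertex -> vertex) : Prop :=
  [/\ bijective f, f [::] = [::] &
      forall u w, tree_adj (f u) (f w) = tree_adj u w].

Record tree_aut : Type := TreeAut {
  tree_aut_fun :> vertex -> vertex;
  tree_aut_subproof : `[< is_tree_aut tree_aut_fun >] }.

HB.instance Definition _ := [isSub for tree_aut_fun].
HB.instance Definition _ := [Choice of tree_aut by <:].

Lemma tree_autP (g : tree_aut) : is_tree_aut g.
Proof. exact/asboolP/tree_aut_subproof. Qed.

Definition mk_tree_aut (f : vertex -> vertex) (hf : is_tree_aut f) : tree_aut :=
  TreeAut (asboolT hf).

Lemma tree_aut_ext (g h : tree_aut) : g =1 h -> g = h.
Proof. by move=> gh; apply/val_inj/funext. Qed.

Lemma is_tree_aut_id : is_tree_aut id.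
Proof. by split=> //; exists id. Qed.

Lemma is_tree_aut_comp (g h : tree_aut) : is_tree_aut (g \o h).
Proof.
have [bg g0 ga] := tree_autP g; have [bh h0 ha] := tree_autP h.
split; [exact: bij_comp | by rewrite /= h0 | by move=> u w /=; rewrite ga ha].
Qed.

Lemma tree_aut_inv_ex (g : tree_aut) :
  exists f : vertex -> vertex, cancel g f /\ cancel f g.
Proof. by have [[f fK gK] _ _] := tree_autP g; exists f. Qed.

Definition tree_aut_invf (g : tree_aut) : vertex -> vertex :=
  sval (cid (tree_aut_inv_ex g)).

Lemma tree_aut_invfK (g : tree_aut) : cancel g (tree_aut_invf g).
Proof. exact: (svalP (cid (tree_aut_inv_ex g))).1. Qed.

Lemma tree_aut_invfKV (g : tree_aut) : cancel (tree_aut_invf g) g.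
Proof. exact: (svalP (cid (tree_aut_inv_ex g))).2. Qed.

Lemma is_tree_aut_inv (g : tree_aut) : is_tree_aut (tree_aut_invf g).
Proof.
have [_ g0 ga] := tree_autP g; split.
- by exists g; [exact: tree_aut_invfKV | exact: tree_aut_invfK].
- by rewrite -[in LHS]g0 tree_aut_invfK.
- by move=> u w; rewrite -ga !tree_aut_invfKV.
Qed.

Definition tree_aut_one : tree_aut := mk_tree_aut is_tree_aut_id.
Definition tree_aut_mul (g h : tree_aut) : tree_aut :=
  mk_tree_aut (is_tree_aut_comp g h).
Definition tree_aut_inv (g : tree_aut) : tree_aut :=
  mk_tree_aut (is_tree_aut_inv g).

Lemma tree_aut_mulA : associative tree_aut_mul.
Proof. by move=> f g h; apply: tree_aut_ext. Qed.
Lemma tree_aut_mul1 : left_id tree_aut_one tree_aut_mul.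
Proof. by move=> g; apply: tree_aut_ext. Qed.
Lemma tree_aut_1mul : right_id tree_aut_one tree_aut_mul.
Proof. by move=> g; apply: tree_aut_ext. Qed.
Lemma tree_aut_mulV : left_inverse tree_aut_one tree_aut_inv tree_aut_mul.
Proof. by move=> g; apply: tree_aut_ext => x; exact: tree_aut_invfK. Qed.
Lemma tree_aut_Vmul : right_inverse tree_aut_one tree_aut_inv tree_aut_mul.
Proof. by move=> g; apply: tree_aut_ext => x; exact: tree_aut_invfKV. Qed.

(* (g * h)%g is composition, g after h: automorphisms act on the left. *)
HB.instance Definition _ := isGroup.Build tree_aut
  tree_aut_mulA tree_aut_mul1 tree_aut_1mul tree_aut_mulV tree_aut_Vmul.

Lemma tree_autM (g h : tree_aut) (x : vertex) : (g * h)%g x = g (h x).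
Proof. by []. Qed.

Lemma tree_autK (g : tree_aut) : cancel g (g^-1)%g.
Proof. exact: tree_aut_invfK. Qed.

Lemma tree_autKV (g : tree_aut) : cancel (g^-1)%g g.
Proof. exact: tree_aut_invfKV. Qed.

Lemma tree_aut0 (g : tree_aut) : g [::] = [::].
Proof. by have [] := tree_autP g. Qed.

Lemma tree_aut_adj (g : tree_aut) u w : tree_adj (g u) (g w) = tree_adj u w.
Proof. by have [] := tree_autP g. Qed.

Lemma tree_aut_rcons (g : tree_aut) (x : vertex) i :
  exists j, g (rcons x i) = rcons (g x) j.
Proof.
elim/last_ind: x i => [|x k IHx] i.
  have : tree_adj (g [::]) (g (rcons [::] i)).
    by rewrite tree_aut_adj; apply/orP; left; apply/existsP; exists i.
  rewrite tree_aut0 => /orP[] /existsP[j /eqP]; first by exists j.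
  by case: (g _).
have : tree_adj (g (rcons x k)) (g (rcons (rcons x k) i)).
  by rewrite tree_aut_adj; apply/orP; left; apply/existsP; exists i.
case/orP=> /existsP[j /eqP gj]; first by exists j.
have [l gl] := IHx k; move: gj; rewrite gl => /rcons_inj[+ _].
move=> /(can_inj (tree_autK g)) /(congr1 size).
by rewrite !size_rcons; lia.
Qed.

Lemma size_tree_aut (g : tree_aut) (x : vertex) : size (g x) = size x.
Proof.
elim/last_ind: x => [|x i IHx]; first by rewrite tree_aut0.
by have [j ->] := tree_aut_rcons g x i; rewrite !size_rcons IHx.
Qed.

Lemma tree_aut_cat (g : tree_aut) (v w : vertex) :
  g (v ++ w) = g v ++ drop (size v) (g (v ++ w)).
Proof.
suff [w' ->] : exists w', g (v ++ w) = g v ++ w'.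
  by rewrite -(size_tree_aut g v) drop_size_cat.
elim/last_ind: w => [|w i [w' IHw]]; first by exists [::]; rewrite !cats0.
rewrite -rcons_cat; have [j ->] := tree_aut_rcons g (v ++ w) i.
by rewrite IHw; exists (rcons w' j); rewrite rcons_cat.
Qed.

Lemma tree_adj_cat (v x y : vertex) : tree_adj (v ++ x) (v ++ y) = tree_adj x y.
Proof.
have childE a b : child (v ++ a) (v ++ b) = child a b.
  by apply: eq_existsb => i; rewrite rcons_cat eqseq_cat// eqxx.
by rewrite /tree_adj !childE.
Qed.

Definition section_fun (v : vertex) (g : tree_aut) (w : vertex) : vertex :=
  drop (size v) (g ((g^-1)%g v ++ w)).

Lemma section_funE (v : vertex) (g : tree_aut) w : g ((g^-1)%g v ++ w) = v ++ section_fun v g w.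
Proof. by rewrite tree_aut_cat tree_autKV size_tree_aut. Qed.

Lemma section_funK (v : vertex) (g : tree_aut) :
  cancel (section_fun v g) (section_fun ((g^-1)%g v) (g^-1)%g).
Proof.
move=> w; rewrite {1}/section_fun invgK tree_autKV -section_funE tree_autK.
by rewrite drop_size_cat.
Qed.

Lemma is_tree_aut_section (v : vertex) (g : tree_aut) : is_tree_aut (section_fun v g).
Proof.
split.
- exists (section_fun ((g^-1)%g v) (g^-1)%g); first exact: section_funK.
  by have := @section_funK ((g^-1)%g v) (g^-1)%g; rewrite invgK tree_autKV.
- by rewrite /section_fun cats0 tree_autKV drop_size.
- move=> x y; rewrite -(tree_adj_cat v) -!section_funE tree_aut_adj.
  exact: tree_adj_cat.
Qed.

(* The section at v is indexed by the image vertex, as in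
   g(uw) = g(u) phi_{g(u)}(g)(w). *)
Definition phi (v : vertex) (g : tree_aut) : tree_aut :=
  mk_tree_aut (is_tree_aut_section v g).

Lemma phiE (g : tree_aut) (v w : vertex) : g (v ++ w) = g v ++ phi (g v) g w.
Proof. by rewrite /= -section_funE tree_autK. Qed.

Definition self_similar (G : {pred tree_aut}) : Prop :=
  forall (g : tree_aut) (v : vertex), g \in G -> phi v g \in G.

Definition spherically_transitive (G : {pred tree_aut}) : Prop :=
  forall n u w, level n u -> level n w -> exists2 g, g \in G & g u = w.

Definition Stab (G : {pred tree_aut}) (A : set vertex) : set tree_aut :=
  [set g | g \in G /\ forall a, A a -> g a = a].

Section HilbertSpace.
Variables (R : realType) (X : choiceType).

Definition sqsum (f : X -> R[i]) : \bar R :=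
  \esum_(x in [set: X]) (normc (f x) ^+ 2)%:E.

Definition square_summable : {pred (X -> R[i])} :=
  fun f => `[< (sqsum f < +oo)%E >].

Lemma sqsum_ge0 f : (0 <= sqsum f)%E.
Proof. by apply: esum_ge0 => x _; rewrite lee_fin sqr_ge0. Qed.

Lemma sqsum0 : sqsum 0 = 0%E.
Proof.
apply: esum1 => x _; rewrite -[(0 : X -> R[i]) x]/(0 : R[i]).
by rewrite normc0 expr0n.
Qed.

Lemma le_sqsumZ (a : R[i]) f :
  (sqsum (a *: f) <= (normc a ^+ 2)%:E * sqsum f)%E.
Proof.
apply: ge_ereal_sup => _ [A [finA _] <-].
rewrite (eq_fsbigr (fun x => (normc a ^+ 2)%:E * (normc (f x) ^+ 2)%:E)%E).
  rewrite -ge0_mule_fsumr//; last by move=> x; rewrite lee_fin sqr_ge0.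
  by apply: lee_wpmul2l; rewrite ?lee_fin ?sqr_ge0//; apply: esum_ge; exists A.
by move=> x _; rewrite -EFinM -exprMn -normcM.
Qed.

Lemma le_sqsumD (f g : X -> R[i]) :
  (sqsum (f + g)%R <= (sqsum f + sqsum g) + (sqsum f + sqsum g))%E.
Proof.
have ge0 (h : X -> R[i]) x : [set: X] x -> (0 <= (normc (h x) ^+ 2)%:E)%E.
  by rewrite lee_fin sqr_ge0.
rewrite /sqsum -!esumD//; try by move=> x _; rewrite ?adde_ge0 ?ge0.
apply: le_esum => x _; rewrite -!EFinD lee_fin.
have := le_normcD (f x) (g x).
have nge0 z : 0 <= normc z :> R by case: z => u v; exact: sqrtr_ge0.
set a := normc (f x); set b := normc (g x) => le_ab.
apply: (@le_trans _ _ ((a + b) ^+ 2)).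
  by rewrite ler_pXn2r ?nnegrE ?addr_ge0 ?nge0.
have : 0 <= (a - b) ^+ 2 by exact: sqr_ge0.
by rewrite sqrrB sqrrD; lra.
Qed.

Lemma square_summable_submod_closed : GRing.submod_closed square_summable.
Proof.
split=> [|a f g /asboolP fl /asboolP gl]; first by apply/asboolP; rewrite sqsum0.
apply/asboolP; apply: le_lt_trans (le_sqsumD _ _) _.
suff afl : (sqsum (a *: f) < +oo)%E by rewrite !lte_add_pinfty.
apply: le_lt_trans (le_sqsumZ _ _) _.
by rewrite lte_mul_pinfty// lee_fin sqr_ge0.
Qed.
HB.instance Definition _ := GRing.isSubmodClosed.Build R[i] (X -> R[i])
  square_summable square_summable_submod_closed.

Record l2 : Type := L2 {
  l2_fun :> X -> R[i];
  l2_subproof : l2_fun \in square_summable }.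

HB.instance Definition _ := [isSub for l2_fun].
HB.instance Definition _ := [Choice of l2 by <:].
HB.instance Definition _ := [SubChoice_isSubLmodule of l2 by <:].

Lemma l2_funD (f g : l2) : l2_fun (f + g) = l2_fun f + l2_fun g.
Proof. by []. Qed.

Lemma l2_funZ (a : R[i]) (f : l2) : l2_fun (a *: f) = a *: l2_fun f.
Proof. by []. Qed.

Definition l2norm (f : l2) : R := Num.sqrt (fine (sqsum f)).

Definition bounded_linear : {pred (l2 -> l2)} :=
  fun T => `[< linear T /\ exists M : R, forall f, l2norm (T f) <= M * l2norm f >].

Lemma l2norm_ge0 f : 0 <= l2norm f.
Proof. exact: sqrtr_ge0. Qed.

Lemma sqsum_l2norm (f : l2) : sqsum f = (l2norm f ^+ 2)%:E.
Proof.
rewrite sqr_sqrtr ?fine_ge0 ?sqsum_ge0// fineK// ge0_fin_numE ?sqsum_ge0//.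
exact/asboolP/l2_subproof.
Qed.

Lemma bounded_linear_submod_closed : GRing.submod_closed bounded_linear.
Proof.
split=> [|a S T /asboolP[Sl [M SM]] /asboolP[Tl [N TN]]].
  apply/asboolP; split=> [b u v|]; first by rewrite /= scaler0 addr0.
  by exists 0 => f; rewrite mul0r /l2norm sqsum0 sqrtr0.
apply/asboolP; split=> [b u v|].
  rewrite -[LHS]/(a *: S (b *: u + v) + T (b *: u + v)).
  rewrite -[RHS]/(b *: (a *: S u + T u) + (a *: S v + T v)).
  rewrite Sl Tl !scalerDr !scalerA [a * b]mulrC -!addrA; congr (_ + _).
  by rewrite addrCA.
pose K := 1 + ((normc a * M) ^+ 2 + N ^+ 2) *+ 2.
have K0 : 0 <= (normc a * M) ^+ 2 + N ^+ 2 by rewrite addr_ge0 ?sqr_ge0.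
have K1 : 1 <= K by rewrite /K lerDl mulrn_wge0.
have le_sqr (U : l2 -> l2) L f : l2norm (U f) <= L * l2norm f ->
    l2norm (U f) ^+ 2 <= L ^+ 2 * l2norm f ^+ 2.
  move=> h; rewrite -exprMn ler_pXn2r// nnegrE ?l2norm_ge0//.
  exact: le_trans (l2norm_ge0 _) h.
exists K => f; have K_ge0 : 0 <= K by exact: le_trans K1.
rewrite -(@ler_pXn2r _ 2)// ?nnegrE ?mulr_ge0 ?l2norm_ge0//.
rewrite exprMn.
have aS : l2norm (a *: S f) ^+ 2 <= normc a ^+ 2 * l2norm (S f) ^+ 2.
  by rewrite -lee_fin [leRHS]EFinM -!sqsum_l2norm l2_funZ; exact: le_sqsumZ.
have : l2norm (a *: S f + T f) ^+ 2 <=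
    (l2norm (a *: S f) ^+ 2 + l2norm (T f) ^+ 2) +
    (l2norm (a *: S f) ^+ 2 + l2norm (T f) ^+ 2).
  by rewrite -lee_fin !EFinD -!sqsum_l2norm l2_funD; exact: le_sqsumD.
move=> /le_trans; apply.
have := le_sqr _ _ _ (TN f); have := le_sqr _ _ _ (SM f).
set x := l2norm f; set y := l2norm (S f); set z := l2norm (T f).
move=> Sy Tz.
have Ky : l2norm (a *: S f) ^+ 2 <= (normc a * M) ^+ 2 * x ^+ 2.
  by apply: le_trans aS _; rewrite exprMn -[leRHS]mulrA ler_wpM2l ?sqr_ge0.
apply: (@le_trans _ _ (K * x ^+ 2)).
  have := sqr_ge0 x; rewrite /K mulrDl mul1r mulrnAl mulrDl; lra.
rewrite ler_wpM2r ?sqr_ge0// expr2 ler_peMl//.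
Qed.
HB.instance Definition _ := GRing.isSubmodClosed.Build R[i] (l2 -> l2)
  bounded_linear bounded_linear_submod_closed.

Record bounded_operator : Type := BoundedOperator {
  bounded_operator_fun :> l2 -> l2;
  bounded_operator_subproof : bounded_operator_fun \in bounded_linear }.

HB.instance Definition _ := [isSub for bounded_operator_fun].
HB.instance Definition _ := [Choice of bounded_operator by <:].
HB.instance Definition _ := [SubChoice_isSubLmodule of bounded_operator by <:].

End HilbertSpace.

Section Representation.
Variables (R : realType).

Lemma sqsum_tree_aut (g : tree_aut) (f : vertex -> R[i]) :
  sqsum (f \o g) = sqsum f.
Proof.
apply/esym/reindex_esum; split=> //.
- by move=> x y _ _ /(can_inj (tree_autK g)).
- by move=> x _; exists (g^-1 x)%g => //; exact: tree_autKV.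
Qed.

Lemma perm_l2_subproof (g : tree_aut) (xi : l2 R vertex) :
  (fun x => xi ((g^-1)%g x)) \in @square_summable R vertex.
Proof.
by apply/asboolP; rewrite (sqsum_tree_aut (g^-1)%g xi); apply/asboolP/l2_subproof.
Qed.

Definition perm_l2 (g : tree_aut) (xi : l2 R vertex) : l2 R vertex :=
  L2 (perm_l2_subproof g xi).

Lemma perm_l2_bounded (g : tree_aut) : perm_l2 g \in @bounded_linear R vertex.
Proof.
apply/asboolP; split=> [a u v|]; first exact/val_inj.
exists 1 => f; rewrite mul1r /l2norm.
by rewrite -[sqsum (perm_l2 g f)]/(sqsum (f \o (g^-1)%g)) sqsum_tree_aut.
Qed.

Definition rho_group (g : tree_aut) : bounded_operator R vertex :=
  BoundedOperator (perm_l2_bounded g).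

Lemma rho_groupE (g : tree_aut) (xi : l2 R vertex) (x : vertex) :
  rho_group g xi x = xi ((g^-1)%g x).
Proof. by []. Qed.

Lemma rho_group1 (xi : l2 R vertex) : rho_group 1%g xi = xi.
Proof.
apply/val_inj/funext => x; rewrite [LHS]rho_groupE; congr (l2_fun _ _).
exact: (tree_autKV 1%g).
Qed.

Lemma rho_groupM (g h : tree_aut) (xi : l2 R vertex) :
  rho_group (g * h)%g xi = rho_group g (rho_group h xi).
Proof.
apply/val_inj/funext => x; rewrite [LHS]rho_groupE [RHS]rho_groupE rho_groupE.
by rewrite invgM.
Qed.

Lemma l2norm_rho_group (g : tree_aut) (xi : l2 R vertex) :
  l2norm (rho_group g xi) = l2norm xi.
Proof.
rewrite /l2norm -[sqsum (rho_group g xi)]/(sqsum (xi \o (g^-1)%g)).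
by rewrite sqsum_tree_aut.
Qed.

(* Only the vector space underlying C[G] is recorded: the convolution product
   of monalg requires a monoid without nontrivial units. *)
Definition group_algebra (G : {pred tree_aut}) : lmodType R[i] :=
  {malg R[i][{g : tree_aut | g \in G}]}.

Definition rho (G : {pred tree_aut}) (a : group_algebra G) :
    bounded_operator R vertex :=
  \sum_(g <- msupp a) a@_g *: rho_group (val g).

Lemma rho_wide (G : {pred tree_aut}) (a : group_algebra G)
    (d : {fset {g : tree_aut | g \in G}}) :
  (msupp a `<=` d)%fset -> rho a = \sum_(g <- d) a@_g *: rho_group (val g).
Proof.
move=> sad; rewrite /rho; apply: big_fset_incl => // g _ /mcoeff_outdom ->.
by rewrite scale0r.
Qed.

Lemma rho_is_linear (G : {pred tree_aut}) : linear (@rho G).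
Proof.
move=> c a b; pose d := (msupp a `|` msupp b `|` msupp (c *: a + b))%fset.
have da : (msupp a `<=` d)%fset by rewrite /d -fsetUA fsubsetUl.
have db : (msupp b `<=` d)%fset by rewrite /d fsubsetU// fsubsetUr.
have dc : (msupp (c *: a + b) `<=` d)%fset by exact: fsubsetUr.
rewrite (rho_wide da) (rho_wide db) (rho_wide dc).
rewrite scaler_sumr -big_split; apply: eq_bigr => g _ /=.
by rewrite mcoeffD mcoeffZ scalerDl scalerA.
Qed.

Lemma rhoU (G : {pred tree_aut}) (g : {g : tree_aut | g \in G}) :
  rho (<< g >> : group_algebra G) = rho_group (val g).
Proof.
rewrite (@rho_wide _ _ [fset g]%fset) ?msuppU_le//.
by rewrite big_seq_fset1 mcoeffU eqxx scale1r.
Qed.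

End Representation.

(* Main.v *)
Require Import Defs.
From HB Require Import structures.
From mathcomp Require Import all_boot all_order all_algebra finmap.
From mathcomp Require Import complex monalg.
From mathcomp Require Import all_classical all_reals.
From mathcomp Require Import ring.

(* Let [K_i] be the subgroup of [G] fixing the first level and the subtree at
   [i]; by transitivity on the first level, all three [K_i] are nontrivial. If
   [g], [h], [l] lie in the [K_i] for the three different letters, then
   [(1 - g) (1 - h) (1 - l)] acts as zero. If [rho] is injective and [g], [h],
   [l] are nontrivial, the coefficient at 1 of this product forces
   [g h l = 1], for all such choices; hence each [K_i] has a single nontrivial
   element [g_i], which is an involution, [t g_i t^-1 = g_(t i)] for [t] in
   [G], and the [g_i] with [i <> l] all agree on the subtree at [l]. They glue
   to an involution of each level commuting with the transitive action of
   [G]. As a level has [3 ^ n] elements, this involution has a fixed point, so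
   it is the identity, and [g_i = 1]: a contradiction. *)

Set Implicit Arguments.
Unset Strict Implicit.
Unset Printing Implicit Defensive.

Import GRing.Theory Num.Theory.
Local Open Scope classical_set_scope.
Local Open Scope ring_scope.

(** Without a fixed point every orbit would have exactly two elements, making the cardinality
    even. *)
Lemma involutive_fixed_point (T : finType) (f : T -> T) :
  involutive f -> odd #|T| -> exists x, f x = x.
Proof.
move=> fK; apply: contraPP => /forallNP nofix.
suff <- : (fcard f T * 2 = #|T|)%N by rewrite oddM andbF.
apply: fcard_order_set => //; first exact: inv_inj.
apply/fintype.subsetP => x _; rewrite inE; apply/eqP.
apply: (@order_cycle _ _ [:: x; f x]); rewrite /= ?fK ?inE ?eqxx //.
by rewrite andbT eq_sym; apply/eqP/nofix.
Qed.

Lemma conj_neq1 (gT : groupType) (g t : gT) :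
  g <> 1%g -> (t * g * t^-1)%g <> 1%g.
Proof.
move=> g1 e; apply: g1; apply: (@mulgI _ t).
by rewrite mulg1 -[LHS](mulgVK t) e mul1g.
Qed.

(** The permutation of the first level induced by [t]. The default [i] of [head] is never reached,
    since [t] preserves length. *)
Definition letter (t : tree_aut) (i : 'I_3) : 'I_3 := head i (t [:: i]).

Lemma letterE (t : tree_aut) i : t [:: i] = [:: letter t i].
Proof.
by rewrite /letter; have := size_tree_aut t [:: i]; case: (t _) => [|j []].
Qed.

Lemma tree_aut_cons (t : tree_aut) i w :
  t (i :: w) = letter t i :: behead (t (i :: w)).
Proof. by rewrite {1}(tree_aut_cat t [:: i] w) letterE /= drop1. Qed.

Lemma letterK (t : tree_aut) : cancel (letter t) (letter (t^-1)%g).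
Proof. by move=> i; rewrite {1}/letter -letterE tree_autK. Qed.

(** This is the subgroup [K_i] of the overview. *)
Definition partial_stab (G : {pred tree_aut}) (i : 'I_3) : set tree_aut :=
  Stab G (subtree [:: i]) `&` Stab G (level 1).

Lemma partial_stabP (G : {pred tree_aut}) i g :
  partial_stab G i g <->
  [/\ g \in G, forall j, letter g j = j & forall w, g (i :: w) = i :: w].
Proof.
split=> [[[gG gi] [_ g1]]|[gG g1 gi]].
  split=> // [j|w]; first by rewrite /letter g1.
  by apply: gi; rewrite /subtree /= eqxx prefix0s.
split; split=> // [[|j w]]; rewrite /subtree /level //=.
  by case: eqP => //= <- _.
by case: w => // _; rewrite letterE g1.
Qed.

Section GroupClosed.
Variable G : {pred tree_aut}.
Hypothesis HG : group_closed G.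

Lemma partial_stab_inv i g : partial_stab G i g -> partial_stab G i (g^-1)%g.
Proof.
move=> /partial_stabP[gG g1 gi]; apply/partial_stabP; split.
- exact: group_closedV.
- by move=> j; rewrite -{1}(g1 j) letterK.
- by move=> w; rewrite -{1}(gi w) tree_autK.
Qed.

Lemma partial_stab_conj i g t : t \in G -> partial_stab G i g ->
  partial_stab G (letter t i) (t * g * t^-1)%g.
Proof.
move=> tG /partial_stabP[gG g1 gi]; apply/partial_stabP; split.
- apply: (group_closedM HG); last exact: group_closedV.
  exact: (group_closedM HG).
- move=> j; have := letterE (t * g * t^-1)%g j.
  rewrite !tree_autM letterE (letterE g) g1 -letterE.
  by rewrite tree_autKV => -[].
- move=> w; rewrite !tree_autM tree_aut_cons letterK gi.
  by rewrite -{1}(letterK t i) -tree_aut_cons tree_autKV.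
Qed.

Lemma partial_stab_nontrivial i : partial_stab G i <> [set 1%g] ->
  exists2 g, partial_stab G i g & g <> 1%g.
Proof.
move=> ne; apply: contrapT => /forall2NP h; apply: ne.
apply/seteqP; split=> g /=.
  by move=> gK; case: (h g) => // /contrapT.
move=> ->; apply/partial_stabP; split=> //; exact: (fst HG).
Qed.

End GroupClosed.

Lemma rhoD (R : realType) (G : {pred tree_aut}) (a b : group_algebra R G) :
  rho (a + b) = rho a + rho b.
Proof. by rewrite -[a]scale1r rho_is_linear !scale1r. Qed.

Lemma letter_cover (i j k : 'I_3) : uniq [:: i; j; k] ->
  forall l, l \in [:: i; j; k].
Proof.
move=> u l; have /(uniq_min_size u) : {subset [:: i; j; k] <= enum 'I_3}.
  by move=> x _; rewrite mem_enum.
by rewrite size_enum_ord => /(_ isT)[_ ->]; rewrite mem_enum.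
Qed.

(* This says that [(1 - g) (1 - h) (1 - l)] acts as zero, with the signs moved
   across the equality; each factor kills one of the three subtrees and
   preserves the other two. *)
Lemma rho_signed_prod (R : realType) (G : {pred tree_aut}) (i j k : 'I_3)
    (g h l : tree_aut) : group_closed G -> uniq [:: i; j; k] ->
  partial_stab G i g -> partial_stab G j h -> partial_stab G k l ->
  rho_group R 1%g + rho_group R (g * h)%g + rho_group R (g * l)%g
    + rho_group R (h * l)%g =
  rho_group R g + rho_group R h + rho_group R l + rho_group R (g * h * l)%g.
Proof.
move=> HG /letter_cover cov gK hK lK.
apply/val_inj/funext => xi; apply/val_inj/funext => x.
pose ev (t : tree_aut) := l2_fun xi ((t^-1)%g x).
rewrite -[LHS]/(ev 1%g + ev (g * h)%g + ev (g * l)%g + ev (h * l)%g).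
rewrite -[RHS]/(ev g + ev h + ev l + ev (g * h * l)%g).
rewrite /ev !invgM !tree_autM invg1 -[(1%g : tree_aut) x]/x.
case: x {ev} => [|m w]; first by rewrite !tree_aut0.
have fixc a t : partial_stab G a t ->
    (forall j, letter (t^-1)%g j = j) /\ (forall w, (t^-1)%g (a :: w) = a :: w).
  by move=> /(partial_stab_inv HG)/partial_stabP[].
have [g1 gi] := fixc _ _ gK; have [h1 hj] := fixc _ _ hK.
have [l1 lk] := fixc _ _ lK.
(* Exposing the head letter [m] of the images under [g^-1] and [h^-1] lets [hj] and [lk] apply to
   them. *)
have gm w' : (g^-1)%g (m :: w') = m :: behead ((g^-1)%g (m :: w')).
  by rewrite {1}tree_aut_cons g1.
have hm w' : (h^-1)%g (m :: w') = m :: behead ((h^-1)%g (m :: w')).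
  by rewrite {1}tree_aut_cons h1.
have := cov m; rewrite !inE => /or3P[] /eqP em; subst m.
- by rewrite gi.
- by rewrite (gm w) !hj -gm; ring.
- by rewrite (gm w) (hm (behead _)) !lk (hm w) lk -!hm -!gm; ring.
Qed.

Section Injective.
Variables (R : realType) (G : {pred tree_aut}).
Hypotheses (HG : group_closed G) (rho_inj : injective (@rho R G)).

(** By injectivity the two formal sums agree in the group algebra, and the coefficient at [x] counts
    occurrences of [x]; characteristic 0 turns this into an equality of natural numbers. *)
Lemma rho_inj_count (s1 s2 s3 s4 t1 t2 t3 t4 x : {t | t \in G}) :
  rho_group R (val s1) + rho_group R (val s2) + rho_group R (val s3)
    + rho_group R (val s4) =
  rho_group R (val t1) + rho_group R (val t2) + rho_group R (val t3)
    + rho_group R (val t4) ->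
  ((s1 == x) + (s2 == x) + (s3 == x) + (s4 == x) =
   (t1 == x) + (t2 == x) + (t3 == x) + (t4 == x))%N.
Proof.
pose U t : group_algebra R G := (<< t >>)%M.
pose S a b c d := U a + U b + U c + U d.
have rhoS a b c d : rho (S a b c d) =
    rho_group R (val a) + rho_group R (val b) + rho_group R (val c)
      + rho_group R (val d).
  by rewrite -!rhoU (rhoD _ (U d)) (rhoD _ (U c)) (rhoD (U a)).
have mcoeffS a b c d : mcoeff x (S a b c d) =
    ((a == x) + (b == x) + (c == x) + (d == x))%:R :> R[i].
  by rewrite !natrD -!mcoeffU -!mcoeffD.
move=> E; apply/eqP; rewrite -(eqr_nat R[i]); apply/eqP.
have SE : S s1 s2 s3 s4 = S t1 t2 t3 t4.
  apply: rho_inj.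
  exact: etrans (rhoS _ _ _ _) (etrans E (esym (rhoS _ _ _ _))).
exact: etrans (esym (mcoeffS _ _ _ _))
  (etrans (congr1 (mcoeff x) SE) (mcoeffS _ _ _ _)).
Qed.

Lemma partial_stab_prod i j k g h l : uniq [:: i; j; k] ->
  partial_stab G i g -> partial_stab G j h -> partial_stab G k l ->
  g <> 1%g -> h <> 1%g -> l <> 1%g -> (g * h * l)%g = 1%g.
Proof.
move=> u gK hK lK g1 h1 l1.
have [/partial_stabP[gG _ _] /partial_stabP[hG _ _] /partial_stabP[lG _ _]] :=
  And3 gK hK lK.
have MG := group_closedM HG.
pose sub (t : tree_aut) (tG : t \in G) : {t | t \in G} := exist _ t tG.
have ghG := MG _ _ gG hG.
(* Count at the identity: it occurs on the left, hence also on the right, where only [g * h * l] can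
   equal it. *)
have := @rho_inj_count (sub _ HG.1) (sub _ ghG) (sub _ (MG _ _ gG lG))
  (sub _ (MG _ _ hG lG)) (sub _ gG) (sub _ hG) (sub _ lG)
  (sub _ (MG _ _ ghG lG)) (sub _ HG.1) (rho_signed_prod R HG u gK hK lK).
have subE t tG : (sub t tG == sub _ HG.1) = (t == 1%g) by [].
rewrite !subE eqxx.
case: (g =P _) => // _; case: (h =P _) => // _; case: (l =P _) => // _.
by case: ((g * h * l)%g =P 1%g).
Qed.

End Injective.

Section EquivariantFamily.
Variables (G : {pred tree_aut}) (g : 'I_3 -> tree_aut).
Hypotheses (Gtrans : spherically_transitive G)
  (g_letter : forall i j, letter (g i) j = j)
  (g_fix : forall i w, g i (i :: w) = i :: w)
  (g_inv : forall i, involutive (g i))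
  (g_conj : forall t i x, t \in G -> t (g i x) = g (letter t i) (t x))
  (g_agree : forall i j l w, i != l -> j != l -> g i (l :: w) = g j (l :: w)).

Lemma equivariant_family_trivial i : g i = 1%g.
Proof.
have Sneq l : ordS l != l :> 'I_3 by case: l => -[|[|[|]]].
(* [ordS (head ord0 x)] is just some letter other than the head of [x]; by
   [g_agree] the choice does not matter. *)
pose s (x : vertex) := g (ordS (head ord0 x)) x.
(* As [s] preserves the head letter, both applications use the same member of the family. *)
have sK : involutive s.
  case=> [|l w]; first by rewrite /s !tree_aut0.
  by rewrite /s [in head _ _]tree_aut_cons g_letter /= g_inv.
apply: tree_aut_ext => -[|l w]; first by rewrite !tree_aut0.
have [->|il] := eqVneq i l; first exact: g_fix.
rewrite -[RHS]/(l :: w) (g_agree _ il (Sneq l)).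
pose n := size (l :: w).
have size_s (u : n.-tuple 'I_3) : size (s u) == n.
  by rewrite size_tree_aut size_tuple.
pose f (u : n.-tuple 'I_3) := Tuple (size_s u).
have [u /(congr1 val) /= fu] : exists u, f u = u.
  apply: involutive_fixed_point => [u|]; first by apply: val_inj; rewrite /= sK.
  by rewrite card_tuple card_ord oddX orbT.
have [t tG] := Gtrans (size_tuple u) (erefl n : level n (l :: w)).
case: (tval u) fu => [|a v]; first by rewrite tree_aut0.
rewrite /s /= => fu tu.
have la : letter t a = l by move: tu; rewrite tree_aut_cons => -[].
(* The index [letter t (ordS a)] also differs from [l], and with it [g_conj] turns the left side
   into [t (g (ordS a) (a :: v))], where [a :: v] is the fixed point. *)
rewrite (@g_agree _ (letter t (ordS a))) //; last first.
  by rewrite -la (inj_eq (can_inj (letterK t))).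
by rewrite -tu -g_conj // fu.
Qed.

End EquivariantFamily.

Theorem proposition4p5 (R : realType) (G : {pred tree_aut})
    (HG : group_closed G)
    (Gself : self_similar G)
    (Gtrans : spherically_transitive G)
    (Gstab : exists2 v : vertex, level 1 v &
       (Stab G (subtree v) `&` Stab G (level 1) <> [set 1%g])%classic) :
  ~ injective (@rho R G).
Proof.
move=> rho_inj.
have [[|i0 []]// _ /(partial_stab_nontrivial HG)[g0 g0K g01]] := Gstab.
have /choice[g gK] (i : 'I_3) : exists g, partial_stab G i g /\ g <> 1%g.
  have [t tG] := Gtrans 1%N [:: i0] [:: i] erefl erefl.
  rewrite letterE => -[<-]; exists (t * g0 * t^-1)%g.
  by split; [exact: partial_stab_conj | exact: conj_neq1].
have g_prod i j k : uniq [:: i; j; k] -> (g i * g j * g k)%g = 1%g.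
  move=> u; have [[iK i1] [jK j1] [kK k1]] := And3 (gK i) (gK j) (gK k).
  exact: (partial_stab_prod HG rho_inj u).
(* The products of [h] and of [g i] with the same two further factors are both 1; cancel on the
   right. *)
have g_uniq i h : partial_stab G i h -> h <> 1%g -> h = g i.
  move=> hK h1; have u : uniq [:: i; ordS i; ordS (ordS i)].
    by case: i {hK} => -[|[|[|]]].
  have [[jK j1] [kK k1]] := (gK (ordS i), gK (ordS (ordS i))).
  have := partial_stab_prod HG rho_inj u hK jK kK h1 j1 k1.
  by rewrite -(g_prod _ _ _ u) => /mulIg /mulIg.
have gP i := (partial_stabP _ _ _).1 (gK i).1.
have g_invg i : (g i)^-1%g = g i.
  apply: g_uniq; first exact: partial_stab_inv HG _ _ (gK i).1.
  by move=> /(congr1 (@monoid.inv _)); rewrite invgK invg1; exact: (gK i).2.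
have g_inv i : involutive (g i) by move=> x; rewrite -{1}g_invg tree_autK.
apply: (gK i0).2; apply: (equivariant_family_trivial Gtrans) => //.
- by move=> i j; have [] := gP i.
- by move=> i w; have [] := gP i.
- move=> t i x tG; rewrite -(@g_uniq (letter t i) (t * g i * t^-1)%g).
  + by rewrite !tree_autM tree_autK.
  + exact: partial_stab_conj HG _ _ _ tG (gK i).1.
  + exact: conj_neq1 (gK i).2.
- move=> i j l w il jl; have [->//|ij] := eqVneq i j.
  (* Apply [g i] to both sides of [g i * g j * g l = 1] evaluated at [l :: w]: the involution [g i]
     cancels, and [g l] fixes [l :: w]. *)
  have := @g_prod i j l; rewrite /= !inE negb_or ij il jl => /(_ isT).
  move=> /(congr1 (fun t : tree_aut => g i (t (l :: w)))).
  by rewrite !tree_autM g_inv; have [_ _ ->] := gP l => ->.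
Qed.
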